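(* Let $X$ be a cell complex with oriented cells $e_\alpha$ such that the closure $\overline e_\alpha$ of each cell has the rational homology of a point. Let $L=L(X)$ be the free graded Lie algebra over $\mathbb Q$ generated by the $e_\alpha$, with $e_\alpha$ in degree $\dim e_\alpha-1$, and write $L=L_0\oplus L_1\oplus L_2\oplus\cdots$ by bracket length ($L_1$ spanned by the generators, $L_k$ by $k$-fold brackets). Let $\delta_1$ be the derivation of $L$ extending the cellular boundary operator $L_1\to L_1$ (degree $-1$), and let $\delta_2$ be the derivation of $L$ extending a local linear map $L_1\to L_2$ of degree $-1$ coming from a local cellular approximation to the diagonal, such that $[\delta_1,\delta_2]=0$. Then there exist local linear maps $\delta_k:L_1\to L_k$ of degree $-1$, $k\ge3$, such that, extending each to a derivation of $L$, the total derivation $\delta=\delta_1+\delta_2+\delta_3+\cdots$ satisfies $\delta\circ\delta=0$.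
   Context: A map $L_1\to L_k$ is local if it sends each generator $e_\alpha$ into the sub-Lie-algebra generated by the cells in the closure of $e_\alpha$. $[\cdot,\cdot]$ denotes the graded commutator of derivations; $\delta\circ\delta=\tfrac12[\delta,\delta]$ for odd $\delta$. *)

(* Defs.v *)
From HB Require Import structures.
From mathcomp Require Import all_boot all_order all_algebra.
From mathcomp Require Import finmap.
From mathcomp Require Import monalg.

Set Implicit Arguments.
Unset Strict Implicit.
Unset Printing Implicit Defensive.

Import Order.TTheory GRing.Theory Num.Theory.
Local Open Scope fset_scope.
Local Open Scope ring_scope.

(* Combinatorial data of a cell complex with oriented cells:           *)
(*  - cells of type [cell], each with a dimension;                     *)
(*  - the (finite) set of cells making up the closure of each cell,    *)
(*    which is assumed to be a subcomplex;                             *)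
(*  - the integer incidence numbers [e_a : e_b] of the cellular        *)
(*    boundary operator  d e_a = sum_b [e_a : e_b] e_b.                *)
Record cell_complex := CellComplex {
  cell : choiceType;
  cdim : cell -> nat;
  clos : cell -> {fset cell};
  inc  : cell -> cell -> int;
  clos_refl  : forall a, a \in clos a;
  clos_sub   : forall a b, b \in clos a -> {subset clos b <= clos a};
  clos_dim   : forall a b, b \in clos a -> b != a -> (cdim b < cdim a)%N;
  inc_supp   : forall a b, inc a b != 0 ->
                 b \in clos a /\ (cdim b).+1 = cdim a;
  inc_inc    : forall a c, \sum_(b <- clos a) inc a b * inc b c = 0
}.

Section CellularHomology.
Variable X : cell_complex.

Definition chain_on (S : {fset cell X}) (n : nat) (c : cell X -> rat) :=
  forall b, c b != 0 -> b \in S /\ cdim b = n.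

Definition bdry (S : {fset cell X}) (c : cell X -> rat) : cell X -> rat :=
  fun b => \sum_(a <- S) c a * (inc a b)%:~R.

(* the subcomplex S has the rational (cellular) homology of a point:
   H_n = 0 for n >= 1, and H_0 = C_0 / B_0 is one-dimensional. *)
Definition rat_homology_point (S : {fset cell X}) : Prop :=
  (forall n c, chain_on S n.+1 c -> (forall b, bdry S c b = 0) ->
     exists c', chain_on S n.+2 c' /\ forall b, bdry S c' b = c b) /\
  (exists z, chain_on S 0 z /\
     ~ (exists c', chain_on S 1 c' /\ forall b, bdry S c' b = z b) /\
     forall c, chain_on S 0 c ->
       exists (q : rat) c', chain_on S 1 c' /\
         forall b, c b = q * z b + bdry S c' b).
End CellularHomology.

(* The free graded Lie algebra L(X) over Q, realized (as usual over Q) *)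
(* as the sub-Lie algebra, for the graded commutator, of the free      *)
(* associative algebra T = Q<e_a> generated by the cells.              *)
Section FreeLie.
Variable X : cell_complex.

Definition T := {malg rat[{fmonom (cell X)}]}.

Definition gen (a : cell X) : T := << fmu a >>.

Definition gdeg (a : cell X) : int := (cdim a)%:Z - 1.
Definition wdeg (w : seq (cell X)) : int := \sum_(a <- w) gdeg a.
Definition gpar (a : cell X) : bool := odd (cdim a).+1. (* parity of gdeg a *)
Definition wpar (w : seq (cell X)) : bool := odd (\sum_(a <- w) (cdim a).+1).

Definition homog (x : T) (d : int) : Prop :=
  forall u, u \in msupp x -> wdeg u = d.

Definition br (x y : T) : T :=
  \sum_(u <- msupp x) \sum_(v <- msupp y)
     (x@_u * y@_v) *: (<< u >> * << v >> -
        (-1) ^+ (wpar u && wpar v) *: (<< v >> * << u >>)).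

Inductive ltree := Leaf of cell X | Node of ltree & ltree.

Fixpoint leval (t : ltree) : T :=
  match t with Leaf a => gen a | Node t1 t2 => br (leval t1) (leval t2) end.

Fixpoint leaves (t : ltree) : seq (cell X) :=
  match t with Leaf a => [:: a] | Node t1 t2 => leaves t1 ++ leaves t2 end.

Definition in_Lie (P : pred (cell X)) (x : T) : Prop :=
  exists s : seq (rat * ltree),
    all (fun p => all P (leaves p.2)) s /\
    x = \sum_(p <- s) p.1 *: leval p.2.

Definition in_L (x : T) : Prop := in_Lie predT x.

Definition in_Lk (k : nat) (x : T) : Prop :=
  exists s : seq (rat * ltree),
    all (fun p => size (leaves p.2) == k) s /\
    x = \sum_(p <- s) p.1 *: leval p.2.

Fixpoint dword (f : cell X -> T) (w : seq (cell X)) : T :=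
  match w with
  | [::] => 0
  | a :: w' => f a * \prod_(b <- w') gen b + (-1) ^+ gpar a *: (gen a * dword f w')
  end.

Definition der (f : cell X -> T) (x : T) : T :=
  \sum_(u <- msupp x) x@_u *: dword f u.

Definition delta1 (a : cell X) : T :=
  \sum_(b <- clos a) (inc a b)%:~R *: gen b.

(* f : L_1 -> L_k (given on generators) is a local linear map of degree -1 *)
Definition local_deg_m1 (k : nat) (f : cell X -> T) : Prop :=
  forall a, in_Lk k (f a) /\ in_Lie (fun b => b \in clos a) (f a) /\
            homog (f a) (gdeg a - 1).
End FreeLie.

(* Main.v *)
(* Let d be the derivation extending the cellular boundary.  Suppose that      *)
(* delta_1, ..., delta_{k-1} are given and that the bracket length components  *)
(* of delta o delta vanish up to k.  The next component asks for a local       *)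
(* delta_k with                                                                *)
(*   d delta_k + delta_k d = - sum_{i+j=k+1, i,j>=2} delta_i delta_j.          *)
(* Working up the skeleta, delta_k(e_a) is a primitive of a d-cycle of         *)
(* L_k(clos a), so it is enough that L_k(clos a) is acyclic for k >= 3.        *)
(*   For this, choose a contraction h of the chains of clos a onto a vertex    *)
(* cycle Z.  The derivation N = d h + h d is homotopic to 0 and acts on words  *)
(* of length k with eigenvalues 0, ..., k, counting the factors complementary  *)
(* to Z.  Hence (N - 1)...(N - k) is (-1)^k k! times the projection onto the   *)
(* line of Z^k; it kills L_k for k >= 3, because Z is odd and [Z, [Z, Z]] = 0. *)
(* On cycles it is also (-1)^k k! id plus a boundary, so cycles are boundaries.*)
Require Import Defs.
From HB Require Import structures.
From mathcomp Require Import all_boot all_order all_algebra.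
From mathcomp Require Import finmap.
From mathcomp Require Import monalg.
From mathcomp Require Import zify ring.
From Stdlib Require ClassicalEpsilon.
Import GRing.Theory Num.Theory.
Set Implicit Arguments.
Unset Strict Implicit.
Unset Printing Implicit Defensive.
Local Open Scope ring_scope.

(** * Odd derivations of a free algebra *)

Section Lspan.
Variable V : lmodType rat.
Implicit Types (G : V -> Prop) (x y : V).

(** Spans as an inductive predicate: a linear claim about an element of a span reduces by induction
    to the spanning elements. *)
Inductive lspan G : V -> Prop :=
| lspan0 : lspan G 0
| lspan_cons c g x : G g -> lspan G x -> lspan G (c *: g + x).

Lemma lspanD G x y : lspan G x -> lspan G y -> lspan G (x + y).
Proof.
move=> Gx Gy; elim: Gx => [|c g z Gg _ IH]; first by rewrite add0r.
by rewrite -addrA; apply: lspan_cons.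
Qed.

Lemma lspanZ G c x : lspan G x -> lspan G (c *: x).
Proof.
elim=> [|c' g z Gg _ IH]; first by rewrite scaler0; apply: lspan0.
by rewrite scalerDr scalerA; apply: lspan_cons.
Qed.

Lemma lspanN G x : lspan G x -> lspan G (- x).
Proof. by rewrite -scaleN1r; apply: lspanZ. Qed.

Lemma lspan_mem G x : G x -> lspan G x.
Proof.
by move=> Gx; rewrite -[x]addr0 -[x in x + _]scale1r; apply: lspan_cons (lspan0 _).
Qed.

Lemma lspan_sum G (I : Type) (r : seq I) (P : pred I) (F : I -> V) :
  (forall i, P i -> lspan G (F i)) -> lspan G (\sum_(i <- r | P i) F i).
Proof.
move=> GF; elim/big_rec: _ => [|i x Pi Gx]; first exact: lspan0.
by apply: lspanD => //; apply: GF.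
Qed.
End Lspan.

Lemma lspan_map (V W : lmodType rat) (G : V -> Prop) (H : W -> Prop)
    (f : {linear V -> W}) x :
  (forall g, G g -> lspan H (f g)) -> lspan G x -> lspan H (f x).
Proof.
move=> GH; elim=> [|c g y Gg _ IH]; first by rewrite linear0; apply: lspan0.
by rewrite linearP; apply: lspanD => //; apply/lspanZ/GH.
Qed.

(* An interface for T X, so that the computations below never unfold the      *)
(* finitely supported functions behind it.                                    *)
Record free_algebra (C : Type) := FreeAlgebra {
  falg :> algType rat;
  word : seq C -> falg;
  lin : (seq C -> falg) -> falg -> falg;
  word_nil : word [::] = 1;
  word_cat : forall u v, word (u ++ v) = word u * word v;
  lin_is_linear : forall F, linear (lin F);
  lin_word : forall F w, lin F (word w) = F w;
  word_lspan : forall x, lspan (fun y => exists w, y = word w) x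
}.

HB.instance Definition _ (C : Type) (A : free_algebra C) (F : seq C -> A) :=
  GRing.isLinear.Build rat A A _ (lin F) (lin_is_linear F).

Section Derivations.
Variables (X : cell_complex) (A : free_algebra (cell X)).
Implicit Types (a b : cell X) (u v w : seq (cell X)) (x y : A).
Implicit Types (f : cell X -> A) (D : nat -> cell X -> A).

Definition fgen a : A := word A [:: a].

Lemma word_cons a w : word A (a :: w) = fgen a * word A w.
Proof. by rewrite -word_cat. Qed.

Lemma free_ind (P : A -> Prop) :
  P 0 -> (forall c x y, P x -> P y -> P (c *: x + y)) ->
  (forall w, P (word A w)) -> forall x, P x.
Proof.
move=> P0 PD Pw x; elim: (word_lspan x) => // c _ y [w ->] _ Py.
exact: PD.
Qed.

Lemma free_gen_ind (P : A -> Prop) :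
  P 1 -> (forall c x y, P x -> P y -> P (c *: x + y)) ->
  (forall a x, P x -> P (fgen a * x)) -> forall x, P x.
Proof.
move=> P1 PD Pg; have Pw w : P (word A w).
  by elim: w => [|a w IH]; rewrite ?word_nil // word_cons; apply: Pg.
apply: free_ind => //; suff -> : 0 = (-1) *: word A [::] + word A [::] by apply: PD.
by rewrite scaleN1r addNr.
Qed.

Lemma wpar_cons a w : wpar (a :: w) = gpar a (+) wpar w.
Proof. by rewrite /wpar big_cons oddD. Qed.

Lemma wpar_cat u v : wpar (u ++ v) = wpar u (+) wpar v.
Proof. by rewrite /wpar big_cat oddD. Qed.

(** The sign automorphism $(-1)^{\deg}$. Koszul signs written through it make the Leibniz rule valid
    for elements that need not be homogeneous. *)
Definition par : A -> A := lin (fun w => (-1) ^+ wpar w *: word A w).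
HB.instance Definition _ := GRing.Linear.on par.

Lemma par_word w : par (word A w) = (-1) ^+ wpar w *: word A w.
Proof. exact: lin_word. Qed.

Lemma par1 : par 1 = 1.
Proof. by rewrite -(word_nil A) par_word /wpar big_nil expr0 scale1r. Qed.

Lemma par_gen_mul a x : par (fgen a * x) = (-1) ^+ gpar a *: (fgen a * par x).
Proof.
elim/free_ind: x => [|c x y IHx IHy|w].
- by rewrite linear0 mulr0 linear0 scaler0.
- rewrite mulrDr -scalerAr !linearP /= IHx IHy mulrDr -scalerAr scalerDr.
  by rewrite !scalerA mulrC.
by rewrite -word_cons !par_word wpar_cons signr_addb -scalerAr -word_cons scalerA.
Qed.

Lemma par_gen a : par (fgen a) = (-1) ^+ gpar a *: fgen a.
Proof. by rewrite -[fgen a]mulr1 par_gen_mul par1. Qed.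

Lemma parM x y : par (x * y) = par x * par y.
Proof.
elim/free_gen_ind: x => [|c x z IHx IHz|a x IH]; first by rewrite par1 !mul1r.
  by rewrite mulrDl -scalerAl !linearP /= IHx IHz mulrDl scalerAl.
by rewrite -mulrA !par_gen_mul IH -scalerAl mulrA.
Qed.

Lemma parK x : par (par x) = x.
Proof.
elim/free_gen_ind: x => [|c x z IHx IHz|a x IH]; first by rewrite !par1.
  by rewrite !linearP /= IHx IHz.
by rewrite par_gen_mul linearZ /= par_gen_mul IH scalerA -signr_addb addbb scale1r.
Qed.

Fixpoint fdword f w : A :=
  if w is a :: w' then
    f a * word A w' + (-1) ^+ gpar a *: (fgen a * fdword f w')
  else 0.

Definition fder f : A -> A := lin (fdword f).
HB.instance Definition _ f := GRing.Linear.on (fder f).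

Lemma fder_word f w : fder f (word A w) = fdword f w.
Proof. exact: lin_word. Qed.

Lemma fder1 f : fder f 1 = 0.
Proof. by rewrite -(word_nil A) fder_word. Qed.

Lemma fder_gen_mul f a x :
  fder f (fgen a * x) = f a * x + par (fgen a) * fder f x.
Proof.
elim/free_ind: x => [|c x y IHx IHy|w].
- by rewrite !(mulr0, linear0) addr0.
- rewrite mulrDr -scalerAr !linearP /= IHx IHy !mulrDr -!scalerAr scalerDr.
  by rewrite addrACA.
by rewrite -word_cons !fder_word /= par_gen scalerAl.
Qed.

Lemma fder_gen f a : fder f (fgen a) = f a.
Proof. by rewrite -[fgen a]mulr1 fder_gen_mul fder1 mulr0 addr0 mulr1. Qed.

Lemma fderM f x y : fder f (x * y) = fder f x * y + par x * fder f y.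
Proof.
elim/free_gen_ind: x => [|c x z IHx IHz|a x IH].
- by rewrite fder1 par1 mul0r add0r !mul1r.
- by rewrite mulrDl -scalerAl !linearP /= IHx IHz !mulrDl -!scalerAl scalerDr addrACA.
by rewrite -mulrA !fder_gen_mul IH parM mulrDl mulrDr !mulrA addrA.
Qed.

(** Values have parity opposite to that of the generator, so [fder f] is an odd derivation. *)
Definition odd_map f := forall a, par (f a) = - ((-1) ^+ gpar a *: f a).

Lemma par_der f x : odd_map f -> par (fder f x) = - fder f (par x).
Proof.
move=> of_; elim/free_gen_ind: x => [|c x z IHx IHz|a x IH].
- by rewrite par1 fder1 linear0 oppr0.
- by rewrite !linearP /= IHx IHz.
have -> : fder f (par (fgen a * x)) =
    (-1) ^+ gpar a *: (f a * par x) + fgen a * fder f (par x).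
  rewrite par_gen_mul linearZ /= fder_gen_mul par_gen scalerDr -scalerAl.
  by rewrite scalerA -signr_addb addbb scale1r.
by rewrite fder_gen_mul linearD /= !parM parK IH of_ mulrN mulNr -scalerAl opprD.
Qed.

(** The component of $\delta\circ\delta$ that raises word length by [m - 2]: when [D i] sends
    letters to words of length [i], its derivation adds [i - 1]. *)
Definition dsum D m x := \sum_(1 <= i < m) fder (D i) (fder (D (m - i)%N) x).

Lemma dsum_linear D m : linear (dsum D m).
Proof.
move=> c x y; rewrite /dsum scaler_sumr -big_split; apply: eq_bigr => i _.
by rewrite !linearP.
Qed.
HB.instance Definition _ D m :=
  GRing.isLinear.Build rat A A _ (dsum D m) (dsum_linear D m).

(* A composite of two odd derivations is not a derivation, but the cross terms *)
(* of D_i D_j and D_j D_i cancel.                                              *)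
Lemma dsumM D m x y : (forall i, (0 < i < m)%N -> odd_map (D i)) ->
  dsum D m (x * y) = dsum D m x * y + x * dsum D m y.
Proof.
move=> oD; pose B i j := fder (D i) (par x) * fder (D j) y.
have E i : (1 <= i < m)%N ->
  fder (D i) (fder (D (m - i)%N) (x * y)) =
    fder (D i) (fder (D (m - i)%N) x) * y
    + x * fder (D i) (fder (D (m - i)%N) y)
    + (B i (m - i)%N - B (m - i)%N i).
  move=> /andP[i0 im]; rewrite fderM linearD /= !fderM parK par_der ?mulNr.
    rewrite -!addrA /B; congr (_ + _); rewrite addrC [_ + x * _]addrC.
    by rewrite addrA.
  by apply: oD; rewrite subn_gt0 im ltn_subrL i0 (ltn_trans i0 im).
rewrite /dsum big_nat (eq_bigr _ E) -big_nat !big_split /= mulr_suml mulr_sumr.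
rewrite sumrN.
suff -> : \sum_(1 <= i < m) B (m - i)%N i = \sum_(1 <= i < m) B i (m - i)%N.
  by rewrite subrr addr0.
rewrite big_nat_rev big_nat [RHS]big_nat; apply: eq_bigr => i /andP[i0 im].
by rewrite add1n subSS subKn // ltnW.
Qed.

(** By [dsumM] the sum is an ordinary derivation, hence determined by its values on generators. *)
Lemma dsum_eq0 D m x : (forall i, (0 < i < m)%N -> odd_map (D i)) ->
  (forall a, dsum D m (fgen a) = 0) -> dsum D m x = 0.
Proof.
move=> oD D0; elim/free_gen_ind: x => [|c x y IHx IHy|a x IH].
- have := dsumM 1 1 oD; rewrite !mul1r mulr1 => E.
  by apply: (addrI (dsum D m 1)); rewrite -E addr0.
- by rewrite linearP /= IHx IHy scaler0 addr0.
by rewrite dsumM // D0 IH mul0r mulr0 addr0.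
Qed.
End Derivations.

(** * Supports, brackets and the free Lie algebra *)

Section Supports.
Variables (X : cell_complex) (A : free_algebra (cell X)).
Implicit Types (a b : cell X) (u v w : seq (cell X)) (x y : A).
Implicit Types (f : cell X -> A) (Q : seq (cell X) -> Prop) (S : pred (cell X)).

Definition supp Q : A -> Prop := lspan (fun y => exists2 w, Q w & y = word A w).

Lemma supp_word Q w : Q w -> supp Q (word A w).
Proof. by move=> Qw; apply: lspan_mem; exists w. Qed.

Lemma supp_weaken Q Q' x : (forall w, Q w -> Q' w) -> supp Q x -> supp Q' x.
Proof.
move=> QQ'; elim=> [|c _ y [w Qw ->] _ IH]; first exact: lspan0.
by apply: lspan_cons => //; exists w => //; apply: QQ'.
Qed.

Lemma suppM Q1 Q2 Q x y : (forall u v, Q1 u -> Q2 v -> Q (u ++ v)) ->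
  supp Q1 x -> supp Q2 y -> supp Q (x * y).
Proof.
move=> QQ sx sy; elim: sx => [|c _ z [u Qu ->] _ IH].
  by rewrite mul0r; apply: lspan0.
rewrite mulrDl -scalerAl; apply: lspanD => //; apply: lspanZ.
elim: sy => [|d _ t [v Qv ->] _ IHt]; first by rewrite mulr0; apply: lspan0.
rewrite mulrDr -scalerAr; apply: lspanD => //; apply: lspanZ.
by rewrite -word_cat; apply/supp_word/QQ.
Qed.

Lemma supp_lin Q Q' (F : seq (cell X) -> A) x :
  (forall w, Q w -> supp Q' (F w)) -> supp Q x -> supp Q' (lin F x).
Proof. by move=> QF; apply: lspan_map => _ [w Qw ->] /=; rewrite lin_word; apply: QF. Qed.

Lemma eq_on_supp (V : lmodType rat) Q (F G : {linear A -> V}) x :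
  (forall w, Q w -> F (word A w) = G (word A w)) -> supp Q x -> F x = G x.
Proof.
move=> FG; elim=> [|c _ y [w Qw ->] _ IH]; first by rewrite !linear0.
by rewrite !linearP IH FG.
Qed.

Lemma wdeg_cat u v : wdeg (u ++ v) = wdeg u + wdeg v.
Proof. by rewrite /wdeg big_cat. Qed.

Lemma wpar_wdeg w : wpar w = odd `|wdeg w|%N.
Proof.
elim: w => [|a w IH]; first by rewrite /wpar /wdeg !big_nil.
rewrite wpar_cons IH /wdeg big_cons -/(wdeg w) /gpar /gdeg; lia.
Qed.

Lemma par_supp (p : bool) x : supp (fun w => wpar w = p) x -> par x = (-1) ^+ p *: x.
Proof.
elim=> [|c _ y [w wp ->] _ IH]; first by rewrite linear0 scaler0.
by rewrite linearP /= IH par_word wp scalerDr !scalerA mulrC.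
Qed.

(** Such an [x] equals its average [(x + (-1)^p par x) / 2], and averaging keeps the words of parity
    [p] and kills the others. *)
Lemma supp_par (p : bool) x : par x = (-1) ^+ p *: x -> supp (fun w => wpar w = p) x.
Proof.
move=> xp; have -> : x = 2%:R^-1 *: (x + (-1) ^+ p *: par x).
  rewrite xp scalerA -signr_addb addbb scale1r -[x in x + x]scale1r -scalerDl.
  by rewrite scalerA mulVf // scale1r.
apply: lspanZ; elim/free_ind: x {xp} => [|c x y IHx IHy|w].
- by rewrite linear0 scaler0 addr0; apply: lspan0.
- rewrite linearP scalerDr scalerA mulrC -scalerA addrACA -scalerDr.
  by apply: lspanD => //; apply: lspanZ.
rewrite par_word scalerA -signr_addb -[X in X + _]scale1r -scalerDl.
case: (eqVneq (wpar w) p) => [wp|]; first by apply/lspanZ/supp_word.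
by case: (p) (wpar w) => [] [] //= _; rewrite addrN scale0r; apply: lspan0.
Qed.

Lemma odd_map_deg f (e : int) : odd `|e| ->
  (forall a, supp (fun w => wdeg w = gdeg a + e) (f a)) -> odd_map f.
Proof.
move=> oe sf a; have s : supp (fun w => wpar w = ~~ gpar a) (f a).
  apply: supp_weaken (sf a) => w; rewrite wpar_wdeg /gpar => ->; rewrite /gdeg; lia.
by rewrite (par_supp s) signrN scaleNr.
Qed.

(** Length, locality and degree are carried together, since the constructions below must respect all
    three. *)
Definition box S k (d : int) w := [/\ size w = k, all S w & wdeg w = d].

Lemma box_cat S j k (d e : int) u v :
  box S j d u -> box S k e v -> box S (j + k) (d + e) (u ++ v).
Proof.
by move=> [<- Su <-] [<- Sv <-]; split; rewrite ?size_cat ?all_cat ?Su ?wdeg_cat.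
Qed.

(** Each term replaces one letter by words of length [i + 1], so [i] is the gain in length and [e]
    the gain in degree. *)
Lemma fder_box S f i (e : int) k d x :
  (forall b, S b -> supp (box S i.+1 (gdeg b + e)) (f b)) ->
  supp (box S k d) x -> supp (box S (k + i) (d + e)) (fder f x).
Proof.
move=> sf; apply: supp_lin => w; elim: w k d => [|a w IH] k d /= [].
  by move=> *; apply: lspan0.
move=> <- /andP[Sa Sw] <-.
have -> : wdeg (a :: w) = gdeg a + wdeg w by rewrite /wdeg big_cons.
have bw : box S (size w) (wdeg w) w by [].
apply: lspanD.
  have -> : ((size w).+1 + i = i.+1 + size w)%N by rewrite addSnnS addnC.
  rewrite addrAC; apply: suppM (sf a Sa) (supp_word bw) => u v; exact: box_cat.
apply: lspanZ; rewrite addSn -add1n -addrA.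
apply: suppM (IH _ _ bw); last apply: supp_word; first exact: box_cat.
by split; rewrite /= ?Sa // /wdeg big_seq1.
Qed.
End Supports.

Section Lie.
Variables (X : cell_complex) (A : free_algebra (cell X)).
Implicit Types (a b : cell X) (u v w : seq (cell X)) (x y : A).
Implicit Types (f : cell X -> A) (t : ltree X).

Definition fbr x y : A :=
  lin (fun u => lin (fun v =>
    word A (u ++ v) - (-1) ^+ (wpar u && wpar v) *: word A (v ++ u)) y) x.

Lemma fbr_linear_l y : linear (fbr^~ y).
Proof. by move=> c x z; rewrite /fbr linearP. Qed.

Lemma fbr_linear_r x : linear (fbr x).
Proof.
move=> c y z; rewrite /fbr; elim/free_ind: x => [|d x t IHx IHt|w].
- by rewrite !linear0 addr0.
- rewrite !(linearP (lin _)) /= IHx IHt !scalerDr !scalerA [d * c]mulrC.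
  by rewrite addrACA.
by rewrite !lin_word linearP.
Qed.
HB.instance Definition _ x :=
  GRing.isLinear.Build rat A A _ (fbr x) (fbr_linear_r x).

Lemma fbr_homog (p q : bool) x y : par x = (-1) ^+ p *: x -> par y = (-1) ^+ q *: y ->
  fbr x y = x * y - (-1) ^+ (p && q) *: (y * x).
Proof.
move=> /supp_par sx /supp_par sy; elim: sx => [|c _ z [u up ->] _ IH].
  by rewrite /fbr linear0 mulr0 mul0r scaler0 subr0.
rewrite fbr_linear_l IH mulrDl mulrDr -scalerAl -scalerAr scalerDr opprD addrACA.
congr (_ + _); rewrite scalerA mulrC -scalerA -scalerBr; congr (_ *: _).
elim: sy => [|d _ t [v vq ->] _ IHt]; first by rewrite linear0 mulr0 mul0r scaler0 subr0.
rewrite linearP /= IHt mulrDl mulrDr -scalerAl -scalerAr scalerDr opprD addrACA.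
congr (_ + _); rewrite scalerA mulrC -scalerA -scalerBr; congr (_ *: _).
by rewrite /fbr !lin_word up vq !word_cat.
Qed.

Fixpoint fleval t : A :=
  match t with Leaf a => fgen A a | Node t1 t2 => fbr (fleval t1) (fleval t2) end.

Lemma fleval_perm t : supp (fun w => perm_eq w (leaves t)) (fleval t).
Proof.
elim: t => [a|t1 IH1 t2 IH2] /=; first exact: supp_word.
apply: supp_lin IH1 => u ut; apply: supp_lin IH2 => v vt.
apply: lspanD; first by apply: supp_word; rewrite perm_cat.
by apply/lspanN/lspanZ/supp_word; rewrite perm_sym perm_catC perm_sym perm_cat.
Qed.

Lemma fleval_par t : par (fleval t) = (-1) ^+ wpar (leaves t) *: fleval t.
Proof.
apply/par_supp/(supp_weaken _ (fleval_perm t)) => w wt.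
by rewrite /wpar (perm_big _ wt).
Qed.

Definition inL : A -> Prop := lspan (fun y => exists t, y = fleval t).

Lemma inL_gen a : inL (fgen A a).
Proof. by apply: lspan_mem; exists (Leaf a). Qed.

Lemma inL_br x y : inL x -> inL y -> inL (fbr x y).
Proof.
move=> Lx Ly; elim: Lx => [|c _ z [t1 ->] _ IH].
  by rewrite /fbr linear0; apply: lspan0.
rewrite fbr_linear_l; apply: lspanD => //; apply: lspanZ.
elim: Ly => [|d _ s [t2 ->] _ IHs]; first by rewrite linear0; apply: lspan0.
rewrite linearP; apply: lspanD => //; apply/lspanZ/lspan_mem.
by exists (Node t1 t2).
Qed.

Lemma fder_br f (p q : bool) x y : odd_map f ->
  par x = (-1) ^+ p *: x -> par y = (-1) ^+ q *: y ->
  fder f (fbr x y) = fbr (fder f x) y + (-1) ^+ p *: fbr x (fder f y).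
Proof.
move=> of_ px py.
have pdx : par (fder f x) = (-1) ^+ (~~ p) *: fder f x.
  by rewrite par_der // px linearZ /= signrN scaleNr.
have pdy : par (fder f y) = (-1) ^+ (~~ q) *: fder f y.
  by rewrite par_der // py linearZ /= signrN scaleNr.
rewrite (fbr_homog px py) (fbr_homog pdx py) (fbr_homog px pdy).
rewrite linearB linearZ /= !fderM px py -!scalerAl.
rewrite scalerDr scalerBr !scalerA -!signr_addb opprD !addrA.
have -> : (p && q) (+) q = ~~ p && q by case: (p) (q) => [] [].
have -> : p (+) (p && ~~ q) = p && q by case: (p) (q) => [] [].
by rewrite addrAC; congr (_ - _); rewrite addrAC.
Qed.

Lemma inL_der f x : odd_map f -> (forall a, inL (f a)) ->
  inL x -> inL (fder f x).
Proof.
move=> of_ Lf; apply: lspan_map => _ [t ->].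
elim: t => [a|t1 IH1 t2 IH2] /=; first by rewrite fder_gen; apply: Lf.
rewrite (fder_br of_ (fleval_par t1) (fleval_par t2)).
have L t : inL (fleval t) by apply: lspan_mem; exists t.
by apply: lspanD; [apply: inL_br | apply/lspanZ/inL_br].
Qed.

(** Each bracket involves only rearrangements of its leaves, so the projection onto the words
    satisfying a permutation-invariant [Q] fixes or kills it. Applied to any expression of [x] by
    brackets, the projection leaves one using only brackets whose leaf word satisfies [Q]. *)
Lemma inL_supp (Q : pred (seq (cell X))) x :
  (forall u v, perm_eq u v -> Q u = Q v) -> inL x -> supp Q x ->
  lspan (fun y => exists2 t, Q (leaves t) & y = fleval t) x.
Proof.
move=> Qp Lx sx; pose F w := if Q w then word A w else 0.
have -> : x = lin F x.
  by rewrite [RHS](eq_on_supp (G := idfun) _ sx) // => w Qw /=; rewrite lin_word /F Qw.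
apply: lspan_map Lx => _ [t ->] /=; have st := fleval_perm t.
case: (boolP (Q (leaves t))) => Qt.
  apply: lspan_mem; exists t => //; rewrite (eq_on_supp (G := idfun) _ st) // => w wt /=.
  by rewrite lin_word /F (Qp _ _ wt) Qt.
rewrite (eq_on_supp (G := \0) _ st) /= => [|w wt]; first exact: lspan0.
by rewrite lin_word /F (Qp _ _ wt) (negbTE Qt).
Qed.
End Lie.

(** * Cellular chains *)

(* Dependent choice along the skeleta. *)
Lemma dim_choice (X : cell_complex) (V : Type) (v0 : V)
    (R : cell X -> (cell X -> V) -> V -> Prop) :
  (forall b g g' v, (forall b', inc b b' != 0 -> g b' = g' b') ->
     R b g v -> R b g' v) ->
  (forall b g, (forall b', inc b b' != 0 -> R b' g (g b')) ->
     exists v, R b g v) ->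
  exists g, forall b, R b g (g b).
Proof.
move=> Rext Rex.
pose pick b g := ClassicalEpsilon.epsilon (inhabits v0) (R b g).
(* [F n] is meant for cells of dimension exactly [n]: faces with nonzero incidence have dimension
   [n - 1], where [F] at the previous level is already right. *)
pose fix F n b {struct n} := if n is m.+1 then pick b (F m) else pick b (fun=> v0).
pose g b := F (cdim b) b.
have gE b : exists2 g', g b = pick b g' & forall b', inc b b' != 0 -> g' b' = g b'.
  rewrite /g; case E : (cdim b) => [|n] /=.
    by exists (fun=> v0) => // b' /inc_supp[_]; rewrite E.
  by exists (F n) => // b' /inc_supp[_]; rewrite E => -[->].
exists g => b; have [n] := ubnP (cdim b); elim: n b => // n IH b bn.
have [g' -> gg'] := gE b; apply: (Rext _ _ _ _ gg').
apply: ClassicalEpsilon.epsilon_spec.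
have [|v Rv] := Rex b g; last by exists v; apply: Rext Rv => b' /gg'.
by move=> b' /inc_supp[_ Eb]; apply: IH; rewrite Eb.
Qed.

Section CellularBoundary.
Variables (X : cell_complex) (A : free_algebra (cell X)).
Implicit Types (a b c : cell X) (S : {fset cell X}) (x y : A).

Definition fdelta1 a : A := \sum_(b <- clos a) (inc a b)%:~R *: fgen A b.
Local Notation d := (fder fdelta1).

Lemma inc_out a b : b \notin clos a -> inc a b = 0.
Proof. by move=> nb; apply/eqP; apply: contraNT nb => /inc_supp[]. Qed.

Lemma sum_clos (V : lmodType rat) S a (F : cell X -> V) : {subset clos a <= S} ->
  \sum_(b <- clos a) (inc a b)%:~R *: F b = \sum_(b <- S) (inc a b)%:~R *: F b.
Proof.
move=> aS; apply: big_fset_incl; first by apply/fsubsetP.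
by move=> b _ nb; rewrite inc_out // scale0r.
Qed.

Lemma fder_delta1 f a : fder f (fdelta1 a) = \sum_(b <- clos a) (inc a b)%:~R *: f b.
Proof.
by rewrite linear_sum /=; apply: eq_bigr => b _; rewrite linearZ /= fder_gen.
Qed.

Lemma fdelta1_box S a : {subset clos a <= S} ->
  supp (box (mem S) 1 (gdeg a - 1)) (fdelta1 a).
Proof.
move=> aS; rewrite /fdelta1 big_seq; apply: lspan_sum => b ba.
have [->|/inc_supp[_ E]] := eqVneq (inc a b) 0; first by rewrite scale0r; apply: lspan0.
apply/lspanZ/supp_word; split=> //=; first by rewrite aS.
by rewrite /wdeg big_seq1 /gdeg -E; lia.
Qed.

Lemma fdelta1_odd : odd_map fdelta1.
Proof.
apply: (@odd_map_deg _ _ _ (-1)) => // a.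
by apply: supp_weaken (fdelta1_box (fun b => id)) => w [].
Qed.

Lemma fdelta1_inL a : inL (fdelta1 a).
Proof. by apply: lspan_sum => b _; apply/lspanZ/inL_gen. Qed.

Lemma fdelta1_vertex a : cdim a = 0%N -> fdelta1 a = 0.
Proof.
move=> a0; apply: big1 => b _; suff -> : inc a b = 0 by rewrite scale0r.
by apply/eqP; apply: contraTT isT => /inc_supp[_]; rewrite a0.
Qed.

Lemma fdelta1_sq a : d (fdelta1 a) = 0.
Proof.
rewrite fder_delta1.
have E b : b \in clos a -> (inc a b)%:~R *: fdelta1 b =
    \sum_(c <- clos a) ((inc a b)%:~R * (inc b c)%:~R) *: fgen A c.
  move=> ba; rewrite /fdelta1 (sum_clos _ (clos_sub ba)) scaler_sumr.
  by apply: eq_bigr => c _; rewrite scalerA.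
rewrite big_seq (eq_bigr _ E) -big_seq exchange_big /= big1 // => c _.
rewrite -scaler_suml; have := congr1 (fun z : int => z%:~R : rat) (inc_inc a c).
rewrite /= rmorph_sum /= => H; rewrite -[RHS](scale0r (fgen A c)); congr (_ *: _).
by rewrite -[RHS]H; apply: eq_bigr => b _; rewrite rmorphM.
Qed.

Lemma d_sq x : d (d x) = 0.
Proof.
have E y : dsum (fun=> fdelta1) 2 y = d (d y) by rewrite /dsum big_nat1.
rewrite -E; apply: dsum_eq0 => [i _|a]; first exact: fdelta1_odd.
by rewrite E fder_gen fdelta1_sq.
Qed.

Lemma d_box S k e x : (forall b, b \in S -> {subset clos b <= S}) ->
  supp (box (mem S) k e) x -> supp (box (mem S) k (e - 1)) (d x).
Proof.
move=> Scl; rewrite -[in X in _ -> X](addn0 k); apply: fder_box => b bS.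
by apply: fdelta1_box; apply: Scl.
Qed.
End CellularBoundary.

Section CellularChains.
Variables (X : cell_complex) (A : free_algebra (cell X)) (S : {fset cell X}).
Hypothesis Scl : forall b, b \in S -> {subset clos b <= S}.
Implicit Types (a b : cell X) (c : cell X -> rat) (x y : A).
Local Notation d := (fder (@fdelta1 X A)).

Definition chain c : A := \sum_(b <- S) c b *: fgen A b.

Lemma chain_supp n c : chain_on S n c -> supp (box (mem S) 1 (n%:Z - 1)) (chain c).
Proof.
move=> cn; apply: lspan_sum => b _.
have [->|/cn[bS bn]] := eqVneq (c b) 0; first by rewrite scale0r; apply: lspan0.
apply/lspanZ/supp_word; split=> //=; first by rewrite bS.
by rewrite /wdeg big_seq1 /gdeg bn.
Qed.

Lemma supp_chain n x : supp (box (mem S) 1 (n%:Z - 1)) x ->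
  exists2 c, chain_on S n c & x = chain c.
Proof.
elim=> [|k _ y [w [w1 Sw wn] ->] _ [c cn ->]].
  exists (fun=> 0) => [b|]; first by rewrite eqxx.
  by rewrite /chain big1 // => b _; rewrite scale0r.
case: w w1 Sw wn => // b [|//] _ /=; rewrite andbT /wdeg big_seq1 /gdeg => bS bn.
exists (fun b' => k * (b' == b)%:R + c b') => [b'|].
  have [->|nb] := eqVneq b' b; first by move=> _; split=> //; lia.
  by rewrite mulr0 add0r; apply: cn.
rewrite /chain; under [RHS]eq_bigr do rewrite scalerDl.
rewrite big_split /=; congr (_ + _); rewrite (big_fsetD1 b) //= eqxx mulr1.
rewrite big_seq big1 ?addr0 // => b'; rewrite !inE => /andP[/negbTE-> _].
by rewrite mulr0 scale0r.
Qed.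

Lemma d_chain c : d (chain c) = chain (bdry S c).
Proof.
rewrite /chain linear_sum /=.
have E a : a \in S -> d (c a *: fgen A a) =
    \sum_(b <- S) (c a * (inc a b)%:~R) *: fgen A b.
  move=> aS; rewrite linearZ /= fder_gen /fdelta1 (sum_clos _ (Scl aS)) scaler_sumr.
  by apply: eq_bigr => b _; rewrite scalerA.
rewrite big_seq (eq_bigr _ E) -big_seq exchange_big /=.
by apply: eq_bigr => b _; rewrite -scaler_suml.
Qed.

Lemma chain_inj c c' : chain c = chain c' -> {in S, c =1 c'}.
Proof.
(* [lin F] reads off the coefficient of the letter [b]. *)
move=> E b bS; pose F w : A := (w == [:: b])%:R.
have cE c1 : lin F (chain c1) = c1 b *: 1.
  rewrite /chain linear_sum (big_fsetD1 b) //= linearZ /= lin_word /F eqxx.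
  rewrite big_seq big1 ?addr0 // => b'; rewrite !inE => /andP[/negbTE nb _].
  by rewrite linearZ /= lin_word /F eqseq_cons nb scaler0.
have /eqP : (c b - c' b) *: (1 : A) = 0 by rewrite scalerBl -!cE E subrr.
by rewrite scaler_eq0 oner_eq0 orbF subr_eq0 => /eqP.
Qed.

Lemma bdry_out c b : b \notin S -> bdry S c b = 0.
Proof.
move=> nb; rewrite /bdry big_seq big1 // => a aS.
rewrite inc_out ?mulr0 //; apply: contra nb; exact: Scl.
Qed.

Hypothesis hpt : rat_homology_point S.

(** Lie degree is dimension minus one, so a natural degree [n] means chains of dimension [n + 1],
    where the homology of a point vanishes. *)
Lemma cycle_boundary (n : nat) x : supp (box (mem S) 1 n) x -> d x = 0 ->
  exists2 y, supp (box (mem S) 1 (n%:Z + 1)) y & d y = x.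
Proof.
have -> : n%:Z = n.+1%:Z - 1 by lia.
move=> /supp_chain[c cn ->]; rewrite d_chain => c0.
have [|c' [c'n bc']] := hpt.1 n c cn.
  move=> b; have [bS|] := boolP (b \in S); last exact: bdry_out.
  apply: (chain_inj (c' := fun=> 0)) => //.
  by rewrite c0 /chain big1 // => b' _; rewrite scale0r.
exists (chain c').
  have -> : n.+1%:Z - 1 + 1 = n.+2%:Z - 1 by lia.
  exact: chain_supp.
by rewrite d_chain; apply: eq_bigr => b _; rewrite bc'.
Qed.

(** Degree -1 holds the vertices and degree 0 the edges: $H_0$ is a line, and [Z] represents a
    generator. *)
Lemma degree0_generator : exists Z : A,
  [/\ supp (box (mem S) 1 (-1)) Z,
      forall y, supp (box (mem S) 1 0) y -> d y <> Z &
      forall x, supp (box (mem S) 1 (-1)) x ->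
        exists (q : rat) y, supp (box (mem S) 1 0) y /\ x = q *: Z + d y].
Proof.
have [z [zn [nz zgen]]] := hpt.2; exists (chain z); split.
- exact: chain_supp zn.
- move=> _ /(@supp_chain 1)[c cn ->]; rewrite d_chain => /chain_inj E; apply: nz.
  exists c; split=> // b; have [/E //|nb] := boolP (b \in S).
  by rewrite bdry_out //; apply/esym/eqP; apply: contraNT nb => /zn[].
move=> _ /(@supp_chain 0)[c cn ->]; have [q [c' [cn' E]]] := zgen _ cn.
exists q, (chain c'); split; first exact: (@chain_supp 1).
rewrite d_chain /chain scaler_sumr -big_split; apply: eq_bigr => b _.
by rewrite E scalerDl scalerA.
Qed.
End CellularChains.

(** * Acyclicity *)

Section Augmentation.
Variables (X : cell_complex) (A : free_algebra (cell X)) (eps : cell X -> rat).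
Implicit Types (b : cell X) (x y : A).

(** The algebra map sending each letter [b] to the scalar [eps b]. On words of length [k] it will
    give the coefficient of the projection onto the line of $Z^k$. *)
Definition aug : A -> A := lin (fun w => (\prod_(b <- w) eps b) *: 1).
HB.instance Definition _ := GRing.Linear.on aug.

Lemma aug_word w : aug (word A w) = (\prod_(b <- w) eps b) *: 1.
Proof. exact: lin_word. Qed.

Lemma aug_gen b : aug (fgen A b) = eps b *: 1.
Proof. by rewrite aug_word big_seq1. Qed.

Lemma aug_scalar x : exists q : rat, aug x = q *: 1.
Proof.
elim/free_ind: x => [|c x y [p px] [q qy]|w].
- by exists 0; rewrite linear0 scale0r.
- by exists (c * p + q); rewrite linearP /= px qy scalerDl scalerA.
by exists (\prod_(b <- w) eps b); rewrite aug_word.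
Qed.

Lemma aug_gen_mul b x : aug (fgen A b * x) = eps b *: aug x.
Proof.
elim/free_ind: x => [|c x y IHx IHy|w].
- by rewrite mulr0 linear0 scaler0.
- rewrite mulrDr -scalerAr !linearP /= IHx IHy.
  by rewrite !scalerA mulrC.
by rewrite -word_cons !aug_word big_cons scalerA.
Qed.

Lemma aug1 : aug 1 = 1.
Proof. by rewrite -(word_nil A) aug_word big_nil scale1r word_nil. Qed.

Lemma augM x y : aug (x * y) = aug x * aug y.
Proof.
elim/free_gen_ind: x => [|c x z IHx IHz|a x IH]; first by rewrite aug1 !mul1r.
  by rewrite mulrDl -scalerAl !linearP /= IHx IHz mulrDl scalerAl.
by rewrite -mulrA !aug_gen_mul IH scalerAl.
Qed.

Hypothesis eps_dim : forall b, cdim b != 0%N -> eps b = 0.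

(* For an odd z the Lie algebra generated by z is spanned by z and [z, z]. *)
Lemma aug_fleval t :
  (aug (fleval A t) = 0) \/
  (size (leaves t) <= 2)%N /\ wpar (leaves t) = odd (size (leaves t)).
Proof.
elim: t => [b|t1 IH1 t2 IH2] /=.
  have [b0|/eps_dim e0] := eqVneq (cdim b) 0%N.
    by right; split=> //; rewrite /wpar big_seq1 b0.
  by left; rewrite aug_gen e0 scale0r.
rewrite (fbr_homog (fleval_par A t1) (fleval_par A t2)) linearB linearZ /= !augM.
case: IH1 => [->|[n1 p1]]; first by left; rewrite mul0r mulr0 scaler0 subr0.
case: IH2 => [->|[n2 p2]]; first by left; rewrite mul0r mulr0 scaler0 subr0.
rewrite wpar_cat size_cat oddD p1 p2.
have [le2|gt2] := leqP (size (leaves t1) + size (leaves t2)) 2; first by right.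
(* Both sizes are at most 2 with sum above 2, so one of them is 2 and the sign is trivial: the
   bracket becomes a commutator of scalars. *)
left; have -> : odd (size (leaves t1)) && odd (size (leaves t2)) = false by lia.
have [q ->] := aug_scalar (fleval A t1); have [r ->] := aug_scalar (fleval A t2).
by rewrite expr0 scale1r !mulr_algl !scalerA mulrC subrr.
Qed.

(** A bracket not killed by [aug] has at most two leaves. The bound on [k] is sharp: for a vertex
    [v], which is odd, $[v,v]=2v^2$ has augmentation [2 (eps v)^2]. *)
Lemma aug_inL k x : (2 < k)%N -> inL x -> supp (fun w => size w = k) x -> aug x = 0.
Proof.
move=> k2 Lx sx.
have sk : supp (fun w => size w == k) x.
  by apply: supp_weaken sx => w ->; rewrite eqxx.
have Qp (u v : seq (cell X)) : perm_eq u v -> (size u == k) = (size v == k).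
  by move=> /perm_size ->.
elim: (inL_supp Qp Lx sk) => [|c _ y [t /eqP tk ->] _ IH]; first by rewrite linear0.
rewrite linearP /= IH.
by have [->|[]] := aug_fleval t; rewrite ?scaler0 ?addr0 // tk; lia.
Qed.
End Augmentation.

Section Eigenspaces.
Variables (X : cell_complex) (A : free_algebra (cell X)) (eps : cell X -> rat).
Variables (N : {linear A -> A}) (Z : A) (S : pred (cell X)).
Hypothesis NM : forall x y, N (x * y) = N x * y + x * N y.
Hypothesis NZ : N Z = 0.
Hypothesis Ngen : forall b, S b -> N (fgen A b) = fgen A b - eps b *: Z.

(** [Nprod k] is $(N-1)\cdots(N-k)$, which kills the eigenvalues 1 to [k]; [Nprod0 k] is
    $N(N-1)\cdots(N-k+1)$, its shift by one. *)
Fixpoint Nprod k x : A :=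
  if k is j.+1 then N (Nprod j x) - j.+1%:R *: Nprod j x else x.

Fixpoint Nprod0 k x : A :=
  if k is j.+1 then N (Nprod0 j x) - j%:R *: Nprod0 j x else x.

Lemma Nprod_linear k : linear (Nprod k).
Proof.
elim: k => [|k IH] c x y //=; rewrite IH linearP /= scalerBr !scalerDr !scalerA.
by rewrite opprD addrACA [_ * c]mulrC.
Qed.
HB.instance Definition _ k := GRing.isLinear.Build rat A A _ (Nprod k) (Nprod_linear k).

Lemma Nprod0S k x : Nprod0 k.+1 x = N (Nprod k x).
Proof.
elim: k => [|k IH]; first by rewrite /= scale0r subr0.
change (N (Nprod0 k.+1 x) - k.+1%:R *: Nprod0 k.+1 x = N (Nprod k.+1 x)).
by rewrite IH [in RHS]/= linearB [N (_ *: _)]linearZ.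
Qed.

(** Since [N (y * x) = y * (N x + x)], each factor $N-j$ becomes $N-(j-1)$ on passing [y]. *)
Lemma Nprod_eigen k x y : N y = y -> Nprod k (y * x) = y * Nprod0 k x.
Proof.
move=> Ny; elim: k => //= k ->; rewrite NM Ny mulrBr -scalerAr -natr1 scalerDl scale1r.
by rewrite [_ *: _ + _]addrC opprD addrACA subrr add0r.
Qed.

Lemma Nprod_ker k x : Nprod k (Z * x) = Z * Nprod k x.
Proof. by elim: k => //= k ->; rewrite NM NZ mul0r add0r mulrBr -scalerAr. Qed.

Lemma N_Zexp k : N (Z ^+ k) = 0.
Proof.
elim: k => [|k IH]; last by rewrite exprS NM NZ IH mul0r mulr0 addr0.
have := NM 1 1; rewrite !mul1r mulr1 => E.
by apply: (addrI (N 1)); rewrite expr0 -E addr0.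
Qed.

Lemma Nprod_word w : all S w ->
  Nprod (size w) (word A w) =
    ((-1) ^+ size w * (size w)`!%:R) *: (aug eps (word A w) * Z ^+ size w).
Proof.
elim: w => [|b w IH] /=; first by rewrite !mul1r scale1r word_nil aug1 mulr1.
(* Split the first letter as [eps b *: Z + y], with [Z] of eigenvalue 0 and [y] of eigenvalue 1. *)
move=> /andP[Sb Sw]; set n := size w; pose y := fgen A b - eps b *: Z.
have Ny : N y = y by rewrite linearB linearZ /= NZ scaler0 subr0 Ngen.
have wE : word A (b :: w) = eps b *: (Z * word A w) + y * word A w.
  by rewrite word_cons mulrBl -scalerAl addrC subrK.
have aE : aug eps (word A (b :: w)) = eps b *: aug eps (word A w).
  by rewrite word_cons aug_gen_mul.
rewrite {}aE wE; change (Nprod n.+1 (eps b *: (Z * word A w) + y * word A w) =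
  ((-1) ^+ n.+1 * n.+1`!%:R) *: (eps b *: aug eps (word A w) * Z ^+ n.+1)).
rewrite Nprod_linear (Nprod_eigen _ _ Ny) Nprod_ker Nprod0S.
have [q Eq] := aug_scalar eps (word A w).
(* By induction [Nprod n] sends the rest of the word to a multiple of $Z^n$, which [N] kills. So the
   [y] part vanishes, and on the [Z] part the last factor contributes $-(n+1)$. *)
have NP : N (Nprod n (word A w)) = 0.
  by rewrite /n IH // Eq mulr_algl !linearZ /= N_Zexp !scaler0.
rewrite NP mulr0 addr0 /= NP sub0r /n IH // -/n.
rewrite Eq -!scalerAl !mul1r mulrN -!scalerAr -exprS -!scaleNr !scalerA.
rewrite factS natrM; congr (_ *: _); rewrite exprS.
by ring.
Qed.
End Eigenspaces.

Section Acyclicity.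
Variables (X : cell_complex) (A : free_algebra (cell X)) (S : {fset cell X}).
Hypothesis Scl : forall b, b \in S -> {subset clos b <= S}.
Hypothesis hpt : rat_homology_point S.
Implicit Types (b : cell X) (x y : A).
Local Notation d1 := (@fdelta1 X A).
Local Notation d := (fder d1).

(** The map [h] is a chain homotopy between the identity and the map [b] to [eps b *: Z]. It is
    built up the skeleta, each value being a primitive of a cycle. *)
Lemma contraction : exists (Z : A) (eps : cell X -> rat) (h : cell X -> A),
  [/\ supp (box (mem S) 1 (-1)) Z,
      forall y, supp (box (mem S) 1 0) y -> d y <> Z,
      forall b, cdim b != 0%N -> eps b = 0,
      forall b, supp (box (mem S) 1 (gdeg b + 1)) (h b) &
      forall b, b \in S -> d (h b) + fder h (d1 b) = fgen A b - eps b *: Z].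
Proof.
have [Z [Z0 Znb Zgen]] := degree0_generator A Scl hpt.
have genS b : b \in S -> supp (box (mem S) 1 (gdeg b)) (fgen A b).
  by move=> bS; apply: supp_word; split; rewrite //= ?bS // /wdeg big_seq1.
(* A vertex is homologous to a multiple [q] of [Z]; [eps] records [q], and [y] serves as the value
   of [h]. *)
pose P b (q : rat) := exists y, supp (box (mem S) 1 0) y /\ fgen A b = q *: Z + d y.
pose eps b := if cdim b == 0%N then ClassicalEpsilon.epsilon (inhabits 0) (P b) else 0.
have epsP b : b \in S -> cdim b = 0%N -> P b (eps b).
  move=> bS b0; rewrite /eps b0 eqxx; apply: ClassicalEpsilon.epsilon_spec.
  by apply: Zgen; have := genS b bS; rewrite /gdeg b0.
(* Setting [h] to 0 off [S] keeps its length, degree and support correct at every cell. *)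
pose R b (h : cell X -> A) v := (b \notin S -> v = 0) /\
  (b \in S -> supp (box (mem S) 1 (gdeg b + 1)) v /\
               d v + fder h (d1 b) = fgen A b - eps b *: Z).
have [|b h IH|h hR] := @dim_choice X A 0 R.
- move=> b g g' v gg' [v0 Rv]; split=> // /Rv[sv <-]; split=> //; congr (_ + _).
  rewrite !fder_delta1; apply: eq_bigr => b' _.
  by have [->|/gg' ->] := eqVneq (inc b b') 0; rewrite ?scale0r.
- have [bS|nb] := boolP (b \in S); last by exists 0; split=> // /(negP nb).
  case Eb : (cdim b) => [|n].
    have [y [sy Ey]] := epsP b bS Eb; exists y; split; first by rewrite bS.
    move=> _; split; first by rewrite /gdeg Eb.
    by rewrite fdelta1_vertex // linear0 addr0 Ey [_ + d y]addrC addrK.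
  have gb : gdeg b = n by rewrite /gdeg Eb; lia.
  have Eh b' : inc b b' != 0 -> [/\ supp (box (mem S) 1 n) (h b'),
      d (h b') + fder h (d1 b') = fgen A b' - eps b' *: Z & cdim b' = n].
    move=> ib; have [bb Ed] := inc_supp ib.
    have [_ /(_ (Scl bS bb)) [sh ->]] := IH _ ib; split=> //; last by lia.
    suff <- : gdeg b' + 1 = n by [].
    by rewrite /gdeg; lia.
  pose x := fgen A b - fder h (d1 b).
  pose e := \sum_(b' <- clos b) (inc b b')%:~R * eps b'.
  have sx : supp (box (mem S) 1 n) x.
    apply: lspanD; first by rewrite -gb; apply: genS.
    apply: lspanN; rewrite fder_delta1; apply: lspan_sum => b' _.
    have [->|/Eh[sh _ _]] := eqVneq (inc b b') 0; last exact: lspanZ.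
    by rewrite scale0r; apply: lspan0.
  (* On the faces of [b], $dh = 1 - \epsilon Z - hd$; with $dd=0$ this leaves $dx =
     \epsilon(db)Z$. *)
  have dx : d x = e *: Z.
    rewrite /x linearB /= fder_gen; apply/eqP; rewrite subr_eq; apply/eqP.
    have -> : d (fder h (d1 b)) = d (fder h (d1 b)) + fder h (d (d1 b)).
      by rewrite fdelta1_sq linear0 addr0.
    rewrite !fder_delta1 !linear_sum -big_split scaler_suml -big_split.
    apply: eq_bigr => b' _ /=.
    have [->|/Eh[_ E _]] := eqVneq (inc b b') 0.
      by rewrite mul0r !scale0r !linear0 !addr0.
    by rewrite !linearZ /= -scalerDr E -scalerA -scalerDr addrC subrK.
  (* Faces of positive dimension have [eps] equal to 0; if [b] is an edge, a nonzero [e] would make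
     [Z] a boundary. *)
  have e0 : e = 0.
    case: n Eb gb Eh sx => [|n] Eb gb Eh sx; last first.
      rewrite /e big1 // => b' _; have [->|/Eh[_ _ Eb']] := eqVneq (inc b b') 0.
        by rewrite mul0r.
      by rewrite /eps Eb' mulr0.
    apply/eqP/negPn/negP => ne; apply: (Znb (e^-1 *: x)); first exact: lspanZ.
    by rewrite linearZ /= dx scalerA mulVf // scale1r.
  have [|y sy Ey] := cycle_boundary Scl hpt sx; first by rewrite dx e0 scale0r.
  exists y; split; first by rewrite bS.
  by move=> _; rewrite gb /eps Eb /= scale0r subr0 Ey subrK.
exists Z, eps, h; split=> // [b /negbTE b0|b|b bS]; first by rewrite /eps b0.
  have [bS|nb] := boolP (b \in S); first by have [_ /(_ bS) []] := hR b.
  by rewrite (hR b).1 //; apply: lspan0.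
by have [_ /(_ bS) []] := hR b.
Qed.

Theorem acyclic k (e : int) x : (2 < k)%N ->
  inL x -> supp (box (mem S) k e) x -> d x = 0 ->
  exists y, [/\ inL y, supp (box (mem S) k (e + 1)) y & d y = x].
Proof.
move=> k2 Lx sx dx.
have [Z [eps [h [sZ Znb eps0 sh hE]]]] := contraction.
have h_odd : odd_map h.
  by apply: (@odd_map_deg _ _ _ 1) => // b; apply: supp_weaken (sh b) => w [].
have h_inL b : inL (h b).
  elim: (sh b) => [|c _ y [w [w1 _ _] ->] _ IH]; first exact: lspan0.
  apply: lspanD => //; apply: lspanZ; case: w w1 => // a [|//] _.
  exact: (inL_gen A a).
(* For this family [dsum D 3] is $dh+hd$, so [dsumM] shows that [N] is a derivation. *)
pose D i := if i == 1%N then d1 else h.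
have D_odd i : (0 < i < 3)%N -> odd_map (D i).
  by rewrite /D; case: eqP => // _ _; apply: fdelta1_odd.
pose N : {linear A -> A} := dsum D 3.
have NE y : N y = d (fder h y) + fder h (d y).
  by rewrite /= /dsum big_ltn // big_nat1.
have NM y z : N (y * z) = N y * z + y * N z by apply: dsumM.
have Ngen b : b \in S -> N (fgen A b) = fgen A b - eps b *: Z.
  by move=> bS; rewrite NE !fder_gen hE.
(* On vertex chains $N = 1-\epsilon Z$, so $NZ = (1-\epsilon(Z))Z$. As [Z] is a cycle, this is also
   $d(hZ)$; since [Z] is not a boundary, the coefficient is 0. *)
have NZ : N Z = 0.
  have [q Eq] := aug_scalar eps Z.
  have dZ : d Z = 0.
    elim: sZ => [|c _ y [w [w1 _ wd] ->] _ IH]; first by rewrite linear0.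
    case: w w1 wd => // a [|//] _; rewrite /wdeg big_seq1 /gdeg => a0.
    rewrite linearP /= IH addr0 [d _]fder_gen fdelta1_vertex ?scaler0 //; lia.
  have NV y : supp (box (mem S) 1 (-1)) y -> N y = y - aug eps y * Z.
    elim=> [|c _ {}y [w [w1 Sw _] ->] _ IH]; first by rewrite !linear0 mul0r subr0.
    case: w w1 Sw => // a [|//] _ /=; rewrite andbT => aS.
    rewrite !linearP /= IH -[word A [:: a]]/(fgen A a) [dsum _ _ _]Ngen // aug_gen.
    by rewrite mulrDl -scalerAl mulr_algl scalerBr opprD addrACA.
  have E : N Z = (1 - q) *: Z by rewrite NV // Eq mulr_algl scalerBl scale1r.
  have [q1|nq] := eqVneq (1 - q) 0; first by rewrite E q1 scale0r.
  case: (Znb ((1 - q)^-1 *: fder h Z)).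
    by apply/lspanZ/(fder_box (i := 0) (e := 1) _ sZ) => b _; apply: sh.
  rewrite linearZ /=; have := NE Z; rewrite dZ linear0 addr0 E => <-.
  by rewrite scalerA mulVf // scale1r.
have Nk : Nprod N k x = 0.
  have augx : aug eps x = 0.
    by apply: (aug_inL eps0 k2 Lx); apply: supp_weaken sx => w [].
  suff -> : Nprod N k x = ((-1) ^+ k * k`!%:R) *: (aug eps x * Z ^+ k).
    by rewrite augx mul0r scaler0.
  elim: {Lx dx augx} sx => [|c _ y [w [wk Sw _] ->] _ IH].
    by rewrite !linear0 mul0r scaler0.
  rewrite Nprod_linear IH -{1}wk (Nprod_word NM NZ Ngen Sw) wk linearP /= mulrDl.
  by rewrite -scalerAl [RHS]scalerDr !scalerA mulrC.
have H_box (e' : int) y : supp (box (mem S) k e') y ->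
    supp (box (mem S) k (e' + 1)) (fder h y).
  by rewrite -[in X in _ -> X](addn0 k); apply: fder_box => b _; apply: sh.
(* On cycles [N] is $dh$, so the factor $N-j$ acts as $-j$ modulo boundaries. Both [d] and [h]
   preserve the Lie algebra, so the primitives stay in it. *)
have step j : [/\ inL (Nprod N j x), supp (box (mem S) k e) (Nprod N j x),
    d (Nprod N j x) = 0 &
    exists y, [/\ inL y, supp (box (mem S) k (e + 1)) y &
                  Nprod N j x = ((-1) ^+ j * j`!%:R) *: x + d y]].
  elim: j => [|j [Lj sj dj [y [Ly sy Ey]]]].
    split=> //; exists 0; split; try exact: lspan0.
    by rewrite linear0 addr0 mulr1 scale1r.
  have NjE : Nprod N j.+1 x = d (fder h (Nprod N j x)) - j.+1%:R *: Nprod N j x.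
    by rewrite -[LHS]/(N _ - _) NE dj linear0 addr0.
  have LH : inL (fder h (Nprod N j x)) by apply: inL_der.
  have sH := H_box _ _ sj; split.
  - rewrite NjE; apply: lspanD; last by apply/lspanN/lspanZ.
    by apply: inL_der => //; [apply: fdelta1_odd | apply: fdelta1_inL].
  - rewrite NjE; apply: lspanD; last by apply/lspanN/lspanZ.
    by rewrite -[e](addrK 1); apply: d_box.
  - by rewrite NjE linearB linearZ /= dj scaler0 d_sq subr0.
  exists (fder h (Nprod N j x) - j.+1%:R *: y); split.
  - by apply: lspanD => //; apply/lspanN/lspanZ.
  - by apply: lspanD => //; apply/lspanN/lspanZ.
  have -> : d (fder h (Nprod N j x) - j.+1%:R *: y) =
      d (fder h (Nprod N j x)) - j.+1%:R *: d y.
    by rewrite linearB /= [d (_ *: _)]linearZ.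
  rewrite NjE {2}Ey scalerDr opprD addrCA; congr (_ + _).
  rewrite -scaleNr scalerA exprS factS natrM; congr (_ *: _).
  by rewrite mulN1r !mulNr mulrCA !mulrA.
have [_ _ _ [y [Ly sy]]] := step k.
(* At [j = k] the left side is 0 and the coefficient $(-1)^k k!$ is invertible, so [x] is a
   boundary. *)
rewrite Nk; set c := (_ * _) => /eqP; rewrite eq_sym addrC addr_eq0 => /eqP E.
have c0 : c != 0 by rewrite mulf_neq0 ?signr_eq0 // pnatr_eq0 -lt0n fact_gt0.
exists (- c^-1 *: y); split; [exact: lspanZ | exact: lspanZ |].
by rewrite linearZ /= E scalerN scaleNr opprK scalerA mulVf // scale1r.
Qed.
End Acyclicity.

(** * The inductive construction *)

Section Construction.
Variables (X : cell_complex) (A : free_algebra (cell X)).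
Hypothesis hpt : forall a : cell X, rat_homology_point (clos a).
Implicit Types (a b : cell X) (x y : A) (f : cell X -> A) (D : nat -> cell X -> A).
Local Notation d1 := (@fdelta1 X A).
Local Notation d := (fder d1).

Definition floc k f :=
  forall a, inL (f a) /\ supp (box (mem (clos a)) k (gdeg a - 1)) (f a).

Lemma floc_odd k f : floc k f -> odd_map f.
Proof.
move=> lf; apply: (@odd_map_deg _ _ _ (-1)) => // a.
by apply: supp_weaken (lf a).2 => w [].
Qed.

Lemma floc_supp k f a b : floc k f -> b \in clos a ->
  supp (box (mem (clos a)) k (gdeg b - 1)) (f b).
Proof.
move=> lf ba; apply: supp_weaken (lf b).2 => w [wk wb wd]; split=> //.
by apply: sub_all wb => c; apply: clos_sub.
Qed.

Lemma floc_delta1 : floc 1 d1.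
Proof. by move=> a; split; [apply: fdelta1_inL | apply: fdelta1_box]. Qed.

Section Step.
Variables (D : nat -> cell X -> A) (k : nat).
Hypothesis k2 : (2 < k)%N.
Hypothesis D1 : D 1%N = d1.
Hypothesis D_loc : forall i, (0 < i < k)%N -> floc i (D i).
Hypothesis D_sum : forall m, (1 < m <= k)%N -> forall x, dsum D m x = 0.

(** The part of [dsum D (k + 1)] made of components already known; the missing terms are $d\delta_k$
    and $\delta_k d$. *)
Definition obstruction x : A :=
  \sum_(2 <= i < k) fder (D i) (fder (D (k.+1 - i)%N) x).

Lemma obstruction_linear : linear obstruction.
Proof.
move=> c x y; rewrite /obstruction scaler_sumr -big_split; apply: eq_bigr => i _.
by rewrite !linearP.
Qed.
HB.instance Definition _ :=
  GRing.isLinear.Build rat A A _ obstruction obstruction_linear.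

(* Both sides are minus the sum of D_p D_q D_r over p + q + r = k + 2 with p, r >= 2. *)
Lemma d_obstruction x : d (obstruction x) = obstruction (d x).
Proof.
pose G p i := fder (D p) (fder (D (i.+1 - p)%N) (fder (D (k.+1 - i)%N) x)).
(* The relation [m = i + 1] rewrites $d\delta_i$; for the other side, [m = k + 2 - p] rewrites
   $\delta_{k+1-p}d$. *)
have EL : d (obstruction x) =
    - \sum_(2 <= i < k) \sum_(2 <= p < k) if (p <= i)%N then G p i else 0.
  rewrite /obstruction linear_sum -sumrN big_nat [RHS]big_nat.
  apply: eq_bigr => i /andP[i2 ik] /=.
  have /D_sum Di : (1 < i.+1 <= k)%N by lia.
  have -> : d (fder (D i) (fder (D (k.+1 - i)%N) x)) =
      - \sum_(2 <= p < i.+1) fder (D p) (fder (D (i.+1 - p)%N) (fder (D (k.+1 - i)%N) x)).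
    apply/eqP; rewrite -addr_eq0; rewrite -[X in _ == X](Di (fder (D (k.+1 - i)%N) x)).
    by rewrite /dsum [X in _ == X]big_ltn ?D1 ?subn1 //; lia.
  congr (- _); rewrite (big_nat_widen 2 i.+1 k) //.
  by rewrite [LHS]big_mkcond.
have ER : obstruction (d x) =
    - \sum_(2 <= p < k) \sum_(2 <= i < k) if (p <= i)%N then G p i else 0.
  rewrite /obstruction -sumrN big_nat [RHS]big_nat.
  apply: eq_bigr => p /andP[p2 pk] /=.
  have /D_sum Dp : (1 < (k.+1 - p).+1 <= k)%N by lia.
  have -> : fder (D (k.+1 - p)%N) (d x) =
      - \sum_(1 <= q < k.+1 - p) fder (D q) (fder (D ((k.+1 - p).+1 - q)%N) x).
    apply/eqP; rewrite -addr_eq0 addrC -[X in _ == X](Dp x).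
    by rewrite /dsum [X in _ == X]big_nat_recr ?D1 ?subSnn ?D1 //=; lia.
  rewrite linearN linear_sum; congr (- _) => /=.
  have -> : (k.+1 - p = k - p.-1)%N by lia.
  have -> : \sum_(2 <= i < k) (if (p <= i)%N then G p i else 0) = \sum_(p <= i < k) G p i.
    by rewrite (big_nat_widenl p 2) // [RHS]big_mkcond.
  have -> : \sum_(p <= i < k) G p i = \sum_(1 + p.-1 <= i < k) G p i.
    by have -> : (1 + p.-1 = p)%N by lia.
  rewrite big_addn big_nat [RHS]big_nat; apply: eq_bigr => q /andP[q1 qk].
  rewrite /G; have -> : ((q + p.-1).+1 - p = q)%N by lia.
  by have -> : (k.+1 - (q + p.-1) = (k - p.-1).+1 - q)%N by lia.
by rewrite EL ER exchange_big_nat.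
Qed.

(** Locality holds because the equation at [a] is solved inside [clos a], which [acyclic] allows,
    after it has been solved on the faces. *)
Lemma extension_step : exists f, floc k f /\
  forall a, d (f a) + obstruction (fgen A a) + fder f (d1 a) = 0.
Proof.
pose R a f v := [/\ inL v, supp (box (mem (clos a)) k (gdeg a - 1)) v &
  d v + obstruction (fgen A a) + fder f (d1 a) = 0].
suff [f fR] : exists f, forall a, R a f (f a).
  by exists f; split=> [a|a]; have [] := fR a.
apply: (@dim_choice X A 0) => [b g g' v gg' [Lv sv E]|a f IH].
  split=> //; rewrite -[RHS]E; congr (_ + _).
  rewrite !fder_delta1; apply: eq_bigr => b' _.
  by have [->|/gg' ->] := eqVneq (inc b b') 0; rewrite ?scale0r.
(* The value that [d (f a)] must take, given [f] on the faces of [a]. *)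
pose x := - (obstruction (fgen A a) + fder f (d1 a)).
have Lx : inL x.
  apply/lspanN/lspanD.
    rewrite /obstruction big_nat; apply: lspan_sum => i ik.
    rewrite fder_gen; apply: inL_der; last by apply: (D_loc _ _).1; lia.
      by apply: floc_odd (D_loc _); lia.
    by move=> b; apply: (D_loc _ _).1; lia.
  rewrite fder_delta1; apply: lspan_sum => b _.
  have [->|/IH[Lb _ _]] := eqVneq (inc a b) 0; last exact: lspanZ.
  by rewrite scale0r; apply: lspan0.
have sx : supp (box (mem (clos a)) k (gdeg a - 1 - 1)) x.
  apply/lspanN/lspanD.
    rewrite /obstruction big_nat; apply: lspan_sum => i ik; rewrite fder_gen.
    have [//|la lk] := @D_loc (k.+1 - i)%N _ a; first by lia.
    have Ek : ((k.+1 - i) + i.-1 = k)%N by lia.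
    rewrite -[in box _ _]Ek; apply: fder_box lk => b ba; have -> : (i.-1.+1 = i)%N by lia.
    by apply: floc_supp ba; apply: D_loc; lia.
  rewrite fder_delta1; apply: lspan_sum => b _.
  have [->|ib] := eqVneq (inc a b) 0; first by rewrite scale0r; apply: lspan0.
  have [ba Eb] := inc_supp ib; apply: lspanZ.
  have [_ sb _] := IH _ ib; apply: supp_weaken sb => w [wk wb wd]; split=> //.
    by apply: sub_all wb => c; apply: clos_sub.
  by rewrite wd /gdeg -Eb; lia.
(* Summing the equations solved on the faces, with $dd=0$, gives
   [d (fder f (d1 a)) = - obstruction (d1 a)]; [d_obstruction] supplies the opposite term. *)
have dx : d x = 0.
  rewrite linearN linearD /= d_obstruction fder_gen.
  suff -> : d (fder f (d1 a)) = - obstruction (d1 a) by rewrite subrr oppr0.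
  have -> : d (fder f (d1 a)) = d (fder f (d1 a)) + fder f (d (d1 a)).
    by rewrite fdelta1_sq linear0 addr0.
  apply/eqP; rewrite -addr_eq0; apply/eqP.
  rewrite !fder_delta1 {2}/fdelta1 !linear_sum -!big_split big1 // => b _ /=.
  have [->|/IH[_ _ E]] := eqVneq (inc a b) 0; first by rewrite !scale0r !linear0 !addr0.
  by rewrite !linearZ /= -!scalerDr -addrA [fder f _ + _]addrC addrA E scaler0.
have [y [Ly sy Ey]] := acyclic (fun b => @clos_sub X a b) (hpt a) k2 Lx sx dx.
exists y; split=> //; first by rewrite subrK in sy.
by rewrite -addrA Ey addNr.
Qed.
End Step.

(** Relation [m] involves only components below [m], so components below [n + 3] suffice for
    relations up to [n + 3]. The first component to construct has index 3. *)
Definition stage d2 n D :=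
  [/\ D 1%N = d1, D 2%N = d2, forall i, (0 < i < n.+3)%N -> floc i (D i) &
      forall m, (1 < m <= n.+3)%N -> forall x, dsum D m x = 0].

Definition upd D k f i := if i == k then f else D i.

Lemma eq_dsum D D' m x : (forall i, (0 < i < m)%N -> D i = D' i) ->
  dsum D m x = dsum D' m x.
Proof.
move=> DD'; rewrite /dsum big_nat [RHS]big_nat; apply: eq_bigr => i im.
by rewrite !DD' //; lia.
Qed.

Lemma stageS d2 n D : stage d2 n D -> exists f, stage d2 n.+1 (upd D n.+3 f).
Proof.
move=> [D1 D2 Dl Ds]; have [//|f [lf Ef]] := extension_step _ D1 Dl Ds.
exists f; have loc i : (0 < i < n.+4)%N -> floc i (upd D n.+3 f i).
  by move=> ik; rewrite /upd; case: eqP => [->//|ne]; apply: Dl; lia.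
split=> // m mk x.
have [->|ne] := eqVneq m n.+4; last first.
  rewrite -[RHS](Ds m _ x); last by lia.
  by apply: eq_dsum => i im; rewrite /upd; case: eqP => // ?; lia.
(* On a generator the two extreme terms are $d f$ and $f d$ and the middle ones form the
   obstruction: this is the equation solved by [f]. *)
apply: dsum_eq0 => [i im|a]; first exact: floc_odd (loc i im).
rewrite -[RHS](Ef a) /dsum big_ltn // big_nat_recr //= addrA.
rewrite /upd /= !subSS subn0 eqxx D1 !fder_gen subSnn /=.
rewrite D1; congr (_ + _ + _); rewrite /obstruction big_nat [RHS]big_nat.
apply: eq_bigr => i ik; rewrite !ifN //; apply/eqP; lia.
Qed.

Theorem extension d2 : floc 2 d2 ->
  (forall a, d (d2 a) + fder d2 (d1 a) = 0) ->
  exists D, [/\ D 1%N = d1, D 2%N = d2, forall k, (0 < k)%N -> floc k (D k) &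
    forall m, (1 < m)%N -> forall x, dsum D m x = 0].
Proof.
move=> l2 E2.
pose pick n D := ClassicalEpsilon.epsilon (inhabits (fun=> 0))
  (fun f => stage d2 n.+1 (upd D n.+3 f)).
(* Values at indices from 3 on start as placeholders. [E n] is final at positive indices up to
   [n + 2], so the diagonal [E i i] is the limit family. *)
pose fix E n := if n is j.+1 then upd (E j) j.+3 (pick j (E j))
  else fun i => if i == 1%N then d1 else d2.
have E0 : stage d2 0 (E 0%N).
  have loc i : (0 < i < 3)%N -> floc i (E 0%N i).
    by case: i => [|[|[]]] //= _; apply: floc_delta1.
  split=> // m m3 x; apply: dsum_eq0 => [i im|a].
    by apply: floc_odd (loc i _); lia.
  (* The case 2 is $d^2=0$; the case 3 is the assumed $[\delta_1,\delta_2]=0$. *)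
  have [->|->] : m = 2%N \/ m = 3%N by lia.
    by rewrite /dsum big_nat1 /= fder_gen fdelta1_sq.
  by rewrite /dsum big_ltn // big_nat1 /= !fder_gen E2.
have ES n : stage d2 n (E n).
  elim: n => // n IH.
  exact: (ClassicalEpsilon.epsilon_spec (inhabits (fun=> 0)) _ (stageS IH)).
have Est n i : (i <= n)%N -> E n i = E i i.
  elim: n => [|n IH]; first by rewrite leqn0 => /eqP->.
  rewrite leq_eqVlt => /predU1P[->//|le_in]; rewrite -IH //= /upd ifN //.
  by apply/eqP; lia.
exists (fun i => E i i); split.
- by have [] := ES 1%N.
- by have [] := ES 2%N.
- by move=> k k0; have [_ _ lk _] := ES k; apply: lk; lia.
move=> m m1 x; have [_ _ _ Em] := ES m; rewrite -[RHS](Em m _ x); last by lia.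
by apply: eq_dsum => i im; rewrite (Est m) //; lia.
Qed.
End Construction.

(** * The monoid algebra T X *)

Lemma malg_scalerAr (R : comNzRingType) (M : monomType) (c : R)
  (x y : {malg R[M]}) : c *: (x * y) = x * (c *: y).
Proof.
apply/malgP => k; rewrite mcoeffZ.
rewrite (mcoeffMlw k (fsubset_refl _) (msuppZ_le _ _)) mcoeffMl mulr_sumr.
apply: eq_bigr => u _; rewrite mulr_sumr; apply: eq_bigr => v _.
by rewrite mcoeffZ mulrnAr !mulrA [c * _]mulrC.
Qed.

Lemma malgU_scale (R : comNzRingType) (M : monomType) (c : R) (u : M) :
  << c *g u >> = c *: << u >>.
Proof. by apply/malgP => k; rewrite mcoeffZ mcoeffU1 mcoeffU mulr_natr. Qed.

Section Concrete.
Variable X : cell_complex.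
Implicit Types (a b : cell X) (u v w : seq (cell X)) (x y : T X).

HB.instance Definition _ := GRing.Lalgebra.on (T X).
HB.instance Definition _ :=
  GRing.Lalgebra_isAlgebra.Build rat (T X) (@malg_scalerAr rat {fmonom (cell X)}).

Definition mword w : T X := << FMonom w >>.

Definition mlin (F : seq (cell X) -> T X) x : T X :=
  \sum_(u <- msupp x) x@_u *: F u.

Lemma mlinEw F (E : {fset {fmonom (cell X)}}) x :
  (msupp x `<=` E)%fset -> mlin F x = \sum_(u <- E) x@_u *: F u.
Proof.
move=> sE; rewrite /mlin (big_fset_incl _ sE) // => u _ /mcoeff_outdom ->.
by rewrite scale0r.
Qed.

Lemma mlin_is_linear F : linear (mlin F).
Proof.
move=> c x y; pose E := (msupp x `|` msupp y)%fset.
have sE : (msupp (c *: x + y) `<=` E)%fset.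
  apply: fsubset_trans (msuppD_le _ _) _.
  by rewrite fsetSU // msuppZ_le.
rewrite !(@mlinEw _ E) ?fsubsetUl ?fsubsetUr // scaler_sumr -big_split /=.
by apply: eq_bigr => u _; rewrite mcoeffD mcoeffZ scalerDl scalerA.
Qed.

Lemma mlin_word F w : mlin F (mword w) = F w.
Proof.
by rewrite /mlin /mword msuppU1 big_seq_fset1 mcoeffU1 eqxx scale1r.
Qed.

Lemma mword_nil : mword [::] = 1.
Proof. by rewrite /mword -fmoneE. Qed.

Lemma mword_cat u v : mword (u ++ v) = mword u * mword v.
Proof.
rewrite /mword malgM_def fgmulUU mulr1.
by have -> : mmul (FMonom u) (FMonom v) = FMonom (u ++ v) := fmmulE _ _.
Qed.

Lemma mword_supp (Q : seq (cell X) -> Prop) x :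
  (forall m : {fmonom (cell X)}, m \in msupp x -> Q m) ->
  lspan (fun y => exists2 w, Q w & y = mword w) x.
Proof.
move=> Qx; rewrite (monalgE x) big_seq; apply: lspan_sum => u ux.
rewrite malgU_scale; apply/lspanZ/lspan_mem; exists u; first exact: Qx.
by rewrite /mword fmK.
Qed.

Lemma mword_lspan x : lspan (fun y => exists w, y = mword w) x.
Proof.
elim: (@mword_supp (fun=> True) x (fun _ _ => I)) => [|c g y [w _ ->] _ IH].
  exact: lspan0.
by apply: lspan_cons => //; exists w.
Qed.

Definition Tfree : free_algebra (cell X) :=
  FreeAlgebra mword_nil mword_cat mlin_is_linear mlin_word mword_lspan.

Lemma msupp_supp (Q : seq (cell X) -> Prop) (x : Tfree) :
  supp Q x <-> (forall m : {fmonom (cell X)}, m \in msupp (x : T X) -> Q m).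
Proof.
split; last exact: mword_supp.
elim=> [|c _ y [w Qw ->] _ IH] u; first by rewrite msupp0.
move/(fsubsetP (msuppD_le _ _)); rewrite in_fsetU => /orP[|/IH //].
by move/(fsubsetP (msuppZ_le _ _)); rewrite msuppU1 in_fset1 => /eqP ->.
Qed.

Lemma gen_fgen a : gen a = fgen Tfree a.
Proof. by rewrite /gen fmuE. Qed.

Lemma prod_gen w : \prod_(b <- w) gen b = word Tfree w.
Proof.
elim: w => [|a w IH]; first by rewrite big_nil word_nil.
by rewrite big_cons IH gen_fgen word_cons.
Qed.

(** Only pointwise equality is asked, so no function extensionality is involved. *)
Lemma der_fder (f : cell X -> T X) (g : cell X -> Tfree) x :
  f =1 g -> der f x = fder g x.
Proof.
move=> fg; have E w : dword f w = fdword g w.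
  elim: w => [|a w IH]; first by reflexivity.
  by rewrite [dword f _]/= [fdword g _]/= IH prod_gen gen_fgen fg; reflexivity.
by apply: eq_bigr => u _; rewrite E.
Qed.

Lemma delta1_fdelta1 a : delta1 a = fdelta1 Tfree a.
Proof. by apply: eq_bigr => b _; rewrite gen_fgen. Qed.

Lemma br_fbr x y : br x y = fbr (x : Tfree) y.
Proof.
rewrite /fbr /= /mlin; apply: eq_bigr => u _; rewrite scaler_sumr.
by apply: eq_bigr => v _; rewrite scalerA !mword_cat /mword !fmK.
Qed.

Lemma leval_fleval t : leval t = fleval Tfree t.
Proof. by elim: t => [a|t1 IH1 t2 IH2] /=; rewrite ?gen_fgen // br_fbr IH1 IH2. Qed.

Lemma lspan_trees (P : pred (seq (cell X))) x :
  lspan (fun y : Tfree => exists2 t, P (leaves t) & y = fleval Tfree t) x <->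
  exists s : seq (rat * ltree X),
    all (fun p => P (leaves p.2)) s /\ x = \sum_(p <- s) p.1 *: leval p.2.
Proof.
split.
  elim=> [|c _ y [t Pt ->] _ [s [sP ->]]]; first by exists [::]; rewrite big_nil.
  by exists ((c, t) :: s); rewrite /= Pt big_cons leval_fleval.
case=> s [sP ->]; elim: s sP => [|[c t] s IH] /=.
  by rewrite big_nil => _; apply: lspan0.
case/andP => Pt /IH IHs; rewrite big_cons; apply: lspan_cons => //.
by exists t; rewrite ?leval_fleval.
Qed.

Lemma trees_inL_supp (P : pred (seq (cell X))) (x : Tfree) :
  (forall u v, perm_eq u v -> P u = P v) ->
  lspan (fun y => exists2 t, P (leaves t) & y = fleval Tfree t) x <->
  inL x /\ supp P x.
Proof.
move=> Pp; split=> [|[Lx Px]]; last exact: (inL_supp Pp Lx Px).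
elim=> [|c _ y [t Pt ->] _ [Ly Py]]; first by split; apply: lspan0.
split; first by apply: lspan_cons => //; exists t.
apply: lspanD => //; apply: lspanZ; apply: supp_weaken (fleval_perm Tfree t).
by move=> w /Pp ->.
Qed.

Lemma in_L_inL (x : T X) : in_L x <-> inL (x : Tfree).
Proof.
split=> [[s [_ ->]]|Lx].
  by apply: lspan_sum => p _; apply/lspanZ/lspan_mem; exists p.2; rewrite leval_fleval.
suff /(lspan_trees predT)[s [_ ->]] :
    lspan (fun y : Tfree => exists2 t, predT (leaves t) & y = fleval Tfree t) x.
  by exists s; split=> //; elim: s => //= p s ->; rewrite all_predT.
by apply/trees_inL_supp => //; split=> //; apply/msupp_supp.
Qed.

(** [local_deg_m1] may use different bracket expressions of [f a] for length and for locality. Both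
    conditions are moved to the words in the support of [f a], where they combine. *)
Lemma local_floc k (f : cell X -> T X) :
  local_deg_m1 k f <-> floc k (f : cell X -> Tfree).
Proof.
have sizeP (u v : seq (cell X)) : perm_eq u v -> (size u == k) = (size v == k).
  by move/perm_size ->.
have allP' a (u v : seq (cell X)) : perm_eq u v ->
    all (mem (clos a)) u = all (mem (clos a)) v.
  by move=> uv; rewrite (perm_all _ uv).
split=> lf a.
  have [fk [fc fd]] := lf a.
  have /(trees_inL_supp _ sizeP)[Lf /msupp_supp sk] :=
    (lspan_trees (fun w => size w == k) _).2 fk.
  have /(trees_inL_supp _ (allP' a))[_ /msupp_supp sa] :=
    (lspan_trees (all (mem (clos a))) _).2 fc.
  split=> //; apply/msupp_supp => m mf; split; [|exact: sa|exact: fd].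
  by apply/eqP/sk.
have [Lf sf] := lf a; split; [|split].
- apply/(lspan_trees (fun w => size w == k))/(trees_inL_supp _ sizeP); split=> //.
  by apply: supp_weaken sf => w [-> _ _].
- apply/(lspan_trees (all (mem (clos a))))/(trees_inL_supp _ (allP' a)); split=> //.
  by apply: supp_weaken sf => w [].
by move/msupp_supp: sf => sf m /sf[].
Qed.
End Concrete.

Theorem mainTheorem8 (X : cell_complex)
  (hpt : forall a : cell X, rat_homology_point (clos a))
  (delta2 : cell X -> T X)
  (h2 : local_deg_m1 2 delta2)
  (hcomm : forall x, in_L x ->
     der (@delta1 X) (der delta2 x) + der delta2 (der (@delta1 X) x) = 0) :
  exists deltak : nat -> cell X -> T X,
    (forall k, (3 <= k)%N -> local_deg_m1 k (deltak k)) /\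
    let D k := if k == 1%N then @delta1 X
               else if k == 2%N then delta2 else deltak k in
    forall m, (2 <= m)%N -> forall x, in_L x ->
      \sum_(1 <= i < m) der (D i) (der (D (m - i)%N) x) = 0.
Proof.
pose A := Tfree X.
have l2 : floc 2 (delta2 : cell X -> A) by apply/local_floc.
have d1E := @delta1_fdelta1 X.
have [a|D [D1 D2 Dl Ds]] := extension hpt l2.
  have /hcomm : in_L (gen a) by apply/in_L_inL; rewrite gen_fgen; apply: inL_gen.
  rewrite !(der_fder _ d1E) !(der_fder (g := delta2) _ (fun=> erefl)).
  by rewrite gen_fgen !fder_gen.
exists D; split=> [k k3|Dk m m2 x _]; first by apply/local_floc/Dl; apply: ltn_trans k3.
have DE k : Dk k =1 D k.
  move=> a; rewrite /Dk; have [->|_] := eqVneq k 1%N; first by rewrite D1 d1E.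
  by have [->|//] := eqVneq k 2%N; rewrite D2.
rewrite -[RHS](Ds m m2 x); apply: eq_bigr => i _.
by rewrite !(der_fder _ (DE _)).
Qed.
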